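(* Let $\mathbb K$ be a field with $2,3\in\mathbb K^\times$, and let $q:\hat{\mathfrak g}\to\mathfrak g$ be a central extension of $3$-graded Lie algebras over $\mathbb K$ with grading elements $\hat E$ and $E=q(\hat E)$, satisfying $\mathfrak g_0=\mathbb KE+[\mathfrak g_+,\mathfrak g_-]$ and $\hat{\mathfrak g}_0=\mathbb K\hat E+[\hat{\mathfrak g}_+,\hat{\mathfrak g}_-]$. Let $q_G:\hat G\to G$ be the induced homomorphism of projective elementary groups. Then $q_G^{-1}(H)=\hat H$ and $q_G^{-1}(P^\pm)=\hat P^\pm$. For the corresponding homogeneous spaces, we have $$\hat G/\hat P^\pm\cong G/P^\pm\quad\text{and}\quad\hat G/\hat H\cong G/H$$ as homogeneous spaces of $\hat G$.
   Context: A $3$-graded Lie algebra with grading element $E\in\mathfrak g$ is a Lie algebra with $\mathrm{ad}(E)^3=\mathrm{ad}(E)$, decomposed as $\mathfrak g=\mathfrak g_+\oplus\mathfrak g_0\oplus\mathfrak g_-$ into the eigenspaces of $\mathrm{ad}(E)$ for $1,0,-1$. A central extension of $3$-graded Lie algebras is a surjective homomorphism of Lie algebras with central kernel that preserves the gradings. For $x\in\mathfrak g_\pm$, $e^{\mathrm{ad}\,x}=1+\mathrm{ad}\,x+\frac12(\mathrm{ad}\,x)^2\in\mathrm{Aut}(\mathfrak g)$. $G\subset\mathrm{Aut}(\mathfrak g)$ is the group generated by all $e^{\mathrm{ad}\,x}$, $x\in\mathfrak g_+\cup\mathfrak g_-$; $U^\pm=e^{\mathrm{ad}\,\mathfrak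 g_\pm}$; $H=\{h\in G:h\circ\mathrm{ad}E=\mathrm{ad}E\circ h\}=\{h\in G:h.E-E\in\mathfrak z(\mathfrak g)\}$; $P^\pm=HU^\pm$. The groups $\hat G,\hat U^\pm,\hat H,\hat P^\pm$ are defined in the same way from $\hat{\mathfrak g}$ and $\hat E$. Each element of $\hat G$ fixes $\ker q$ pointwise, hence induces an automorphism of $\mathfrak g$; $q_G:\hat G\to G$ is the group homomorphism determined by $q_G(g)\circ q=q\circ g$ for $g\in\hat G$. $\hat G$ acts on $G/P^\pm$ and $G/H$ through $q_G$. *)

(* Defs.v *)
From HB Require Import structures.
From mathcomp Require Import all_boot all_order all_algebra.
From mathcomp Require Import ssrAC ring.
From mathcomp Require Import boolp classical_sets functions.

Set Implicit Arguments.
Unset Strict Implicit.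
Unset Printing Implicit Defensive.
Import GRing.Theory.
Local Open Scope ring_scope.
Local Open Scope classical_set_scope.

HB.mixin Record Lmodule_isLieAlgebra (K : fieldType) (L : Type)
    of GRing.Lmodule K L := {
  bracket : L -> L -> L;
  bracket_linearr : forall x : L, linear (bracket x);
  bracket_linearl : forall y : L, linear (bracket^~ y);
  bracketxx : forall x : L, bracket x x = 0;
  jacobi : forall x y z : L,
    bracket x (bracket y z) + bracket y (bracket z x)
      + bracket z (bracket x y) = 0 }.

#[short(type="lieAlgType")]
HB.structure Definition LieAlgebra (K : fieldType) :=
  {L of GRing.Lmodule K L & Lmodule_isLieAlgebra K L}.

Notation ad := bracket (only parsing).

Section BracketTheory.
Variables (K : fieldType) (L : lieAlgType K).
Implicit Types x y z : L.

Lemma bracketDr x y z : bracket x (y + z) = bracket x y + bracket x z.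
Proof. by have := bracket_linearr x 1 y z; rewrite !scale1r. Qed.

Lemma bracketDl x y z : bracket (x + y) z = bracket x z + bracket y z.
Proof. by have := bracket_linearl z 1 x y; rewrite !scale1r. Qed.

Lemma bracketr0 x : bracket x 0 = 0.
Proof. by apply: (addrI (bracket x 0)); rewrite -bracketDr !addr0. Qed.

Lemma bracket0l x : bracket 0 x = 0.
Proof. by apply: (addrI (bracket 0 x)); rewrite -bracketDl !addr0. Qed.

Lemma bracketZr c x y : bracket x (c *: y) = c *: bracket x y.
Proof. by have := bracket_linearr x c y 0; rewrite !addr0 bracketr0 addr0. Qed.

Lemma bracketZl c x y : bracket (c *: x) y = c *: bracket x y.
Proof. by have := bracket_linearl y c x 0; rewrite !addr0 bracket0l addr0. Qed.

Lemma bracketC x y : bracket x y = - bracket y x.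
Proof.
apply/eqP; rewrite -addr_eq0; apply/eqP.
by have := bracketxx (x + y); rewrite bracketDl !bracketDr !bracketxx add0r addr0.
Qed.

Lemma bracketNr x y : bracket x (- y) = - bracket x y.
Proof. by rewrite -scaleN1r bracketZr scaleN1r. Qed.

Lemma bracketNl x y : bracket (- x) y = - bracket x y.
Proof. by rewrite -scaleN1r bracketZl scaleN1r. Qed.

Lemma ad_derivation x y z :
  ad x (bracket y z) = bracket (ad x y) z + bracket y (ad x z).
Proof.
have := jacobi x y z; rewrite (bracketC z x) bracketNr (bracketC z (bracket x y)).
by move/eqP; rewrite subr_eq0 subr_eq => /eqP ->.
Qed.

End BracketTheory.

Definition lie_center (K : fieldType) (L : lieAlgType K) : set L :=
  [set z | forall x : L, bracket z x = 0].

HB.mixin Record LieAlgebra_is3Graded (K : fieldType) (L : Type)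
    of LieAlgebra K L := {
  gradeE : L;
  ad_gradeE3 : forall x : L,
    ad gradeE (ad gradeE (ad gradeE x)) = ad gradeE x }.

#[short(type="gradedLieType")]
HB.structure Definition GradedLie (K : fieldType) :=
  {L of LieAlgebra K L & LieAlgebra_is3Graded K L}.

Arguments gradeE {K} s : rename.

(* Only the degrees i = 1, 0, -1 are used. *)
Definition grade (K : fieldType) (L : gradedLieType K) (i : int) : set L :=
  [set x | ad (gradeE L) x = x *~ i].
Arguments grade {K} L i.

(* [A, B] is the linear span of all brackets; scalars need not appear when A
   is a linear subspace, since they can be absorbed in the first argument. *)
Definition bracket_span (K : fieldType) (L : lieAlgType K) (A B : set L) :
  set L :=
  [set v | exists n (a b : 'I_n -> L),
     [/\ forall i, A (a i), forall i, B (b i) &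
         v = \sum_(i < n) bracket (a i) (b i)]].

Definition grade0_generated (K : fieldType) (L : gradedLieType K) : Prop :=
  grade L 0 = [set c *: gradeE L + v | c in [set: K] &
                 v in bracket_span (grade L 1) (grade L (- 1))].
Arguments grade0_generated {K} L.

Record lieAut (K : fieldType) (L : lieAlgType K) := LieAut {
  lieAut_fun :> L -> L;
  lieAut_linear : linear lieAut_fun;
  lieAut_bracket : {morph lieAut_fun : x y / bracket x y};
  lieAut_bij : bijective lieAut_fun }.

Section LieAutGroup.
Variables (K : fieldType) (L : lieAlgType K).
Implicit Types a b c : lieAut L.

Lemma lieAutP a b : a =1 b -> a = b.
Proof.
case: a b => [f f1 f2 f3] [g g1 g2 g3] /= /funext fg; subst g.
by rewrite (Prop_irrelevance f1 g1) (Prop_irrelevance f2 g2)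
  (Prop_irrelevance f3 g3).
Qed.

HB.instance Definition _ := gen_eqMixin (lieAut L).
HB.instance Definition _ := gen_choiceMixin (lieAut L).

Definition lieAut_one : lieAut L.
Proof. by exists id => //; exists id. Defined.

Definition lieAut_mul a b : lieAut L.
Proof.
exists (a \o b).
- by move=> k x y /=; rewrite !lieAut_linear.
- by move=> x y /=; rewrite !lieAut_bracket.
- exact: bij_comp (lieAut_bij a) (lieAut_bij b).
Defined.

Lemma lieAut_inv_ex a : exists b, cancel a b /\ cancel b a.
Proof.
have [g ag ga] := lieAut_bij a.
have lg : linear g.
  by move=> k x y; apply: (can_inj ag); rewrite lieAut_linear !ga.
have mg : {morph g : x y / bracket x y}.
  by move=> x y; apply: (can_inj ag); rewrite lieAut_bracket !ga.
by exists (LieAut lg mg (Bijective ga ag)).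
Qed.

Definition lieAut_inv a : lieAut L := sval (cid (lieAut_inv_ex a)).

Lemma lieAut_mulA : associative lieAut_mul.
Proof. by move=> a b c; apply: lieAutP. Qed.
Lemma lieAut_mul1 : left_id lieAut_one lieAut_mul.
Proof. by move=> a; apply: lieAutP. Qed.
Lemma lieAut_mulr1 : right_id lieAut_one lieAut_mul.
Proof. by move=> a; apply: lieAutP. Qed.
Lemma lieAut_mulV : left_inverse lieAut_one lieAut_inv lieAut_mul.
Proof.
move=> a; apply: lieAutP => x /=; rewrite /lieAut_inv.
by case: cid => b [/= ab _]; rewrite ab.
Qed.
Lemma lieAut_mulrV : right_inverse lieAut_one lieAut_inv lieAut_mul.
Proof.
move=> a; apply: lieAutP => x /=; rewrite /lieAut_inv.
by case: cid => b [/= _ ba]; rewrite ba.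
Qed.

HB.instance Definition _ := isGroup.Build (lieAut L) lieAut_mulA
  lieAut_mul1 lieAut_mulr1 lieAut_mulV lieAut_mulrV.

Lemma lieAut1E (x : L) : (1%g : lieAut L) x = x. Proof. by []. Qed.
Lemma lieAutME a b x : (a * b)%g x = a (b x). Proof. by []. Qed.

End LieAutGroup.

Definition gen_subgroup (G : groupType) (S : set G) : set G :=
  smallest (fun A : set G => group_closed (mem A)) S.

(* Truncated after degree 2, as (ad x)^3 = 0 for x of degree 1 or -1; it is then
   an automorphism by exp_ad_aut, so that every such x contributes to elem_gens
   and elemU below. *)
Definition exp_ad (K : fieldType) (L : lieAlgType K) (x y : L) : L :=
  y + ad x y + 2%:R^-1 *: ad x (ad x y).

Section ElementaryGroup.
Variables (K : fieldType) (L : gradedLieType K).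

Definition elem_gens : set (lieAut L) :=
  [set a : lieAut L | exists2 x : L, (grade L 1 `|` grade L (- 1)) x & a =1 exp_ad x].

Definition in_elemGroup : pred (lieAut L) :=
  fun a => a \in gen_subgroup elem_gens.

Lemma in_elemGroup_closed : group_closed in_elemGroup.
Proof.
split; first by rewrite unfold_in; apply/mem_set => A [[A1 _] _]; apply/set_mem.
move=> a b; rewrite !unfold_in => /set_mem Ga /set_mem Gb.
apply/mem_set => A HA; apply/set_mem; case: (HA) => -[_ AF] _.
by apply: AF; apply/mem_set; [apply: Ga | apply: Gb].
Qed.

Record elemGroup := ElemGroup {
  elem_val :> lieAut L;
  elem_valP : in_elemGroup elem_val }.

HB.instance Definition _ := [isSub for elem_val].
HB.instance Definition _ := [Choice of elemGroup by <:].
HB.instance Definition _ :=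
  SubChoice_isSubGroup.Build (lieAut L) in_elemGroup elemGroup
    in_elemGroup_closed.

Lemma elemME (a b : elemGroup) x : (a * b)%g x = a (b x). Proof. by []. Qed.

Definition elemH : set elemGroup :=
  [set h : elemGroup | forall x : L, h (ad (gradeE L) x) = ad (gradeE L) (h x)].

Definition elemU (i : int) : set elemGroup :=
  [set u : elemGroup | exists2 x : L, grade L i x & u =1 exp_ad x].

Definition elemP (i : int) : set elemGroup :=
  [set (h * u)%g | h in elemH & u in elemU i].

End ElementaryGroup.

Arguments elemGroup {K} L.
Arguments elemH {K} L.
Arguments elemU {K} L i.
Arguments elemP {K} L i.

Section ExpAd.
Variables (K : fieldType) (L : gradedLieType K).
Hypotheses (K2 : 2%:R != 0 :> K) (K3 : 3%:R != 0 :> K).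

Lemma exp_ad_aut (x : L) : (grade L 1 `|` grade L (- 1)) x ->
  exists a : lieAut L, a =1 exp_ad x.
Proof.
move=> gx.
have [s s2 Ex] : exists2 s : K, s * s = 1 & ad (gradeE L) x = s *: x.
  case: gx => /= ->; first by exists 1; rewrite ?mulr1 ?scale1r.
  by exists (-1); rewrite ?mulrNN ?mulr1 // scaleN1r.
pose E := gradeE L; pose V (t : K) (y : L) := ad E y = t *: y.
have s0 : s != 0 by apply: contra_eq_neq s2 => ->; rewrite mul0r eq_sym oner_eq0.
have VD t u y z : V t y -> V u z -> V (t + u) (bracket y z).
  by move=> hy hz; rewrite /V ad_derivation hy hz bracketZl bracketZr scalerDl.
have V2 y : V (s + s) y -> y = 0.
  move=> hy; have := ad_gradeE3 y; rewrite -/E hy !bracketZr hy !bracketZr hy.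
  rewrite !scalerA => /eqP; rewrite -subr_eq0 -scalerBl scaler_eq0.
  case/orP => [|/eqP//].
  have -> : (s + s) * (s + s) * (s + s) - (s + s) = s * (2%:R * 3%:R) :> K.
    transitivity ((s * s) * s * 8%:R - s * 2%:R); first by ring.
    by rewrite s2; ring.
  by rewrite !mulf_eq0 (negPf s0) (negPf K2) (negPf K3).
pose D := ad x.
have DV t y : V t y -> V (s + t) (D y) by exact: VD.
have dec y : exists y1 y2 y3, [/\ V s y1, V 0 y2, V (- s) y3 & y = y1 + y2 + y3].
  pose e2 := ad E (ad E y).
  exists (2%:R^-1 *: (e2 + s *: ad E y)), (y - e2), (2%:R^-1 *: (e2 - s *: ad E y)).
  have eee : ad E e2 = ad E y by exact: ad_gradeE3.
  split.
  - rewrite /V bracketZr bracketDr bracketZr eee -/e2 [RHS]scalerA.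
    rewrite (mulrC s) -[RHS]scalerA [in RHS]scalerDr scalerA s2 scale1r.
    by rewrite addrC.
  - by rewrite /V bracketDr bracketNr eee subrr scale0r.
  - rewrite /V bracketZr bracketDr bracketNr bracketZr eee -/e2.
    rewrite [RHS]scalerA (mulrC (- s)) -[RHS]scalerA [in RHS]scalerBr.
    by rewrite !scaleNr scalerA s2 scale1r opprK addrC.
  - rewrite addrAC -scalerDr addrACA subrr addr0 -mulr2n -scaler_nat scalerA.
    by rewrite mulVf // scale1r addrC subrK.
have D0 : D 0 = 0 by exact: bracketr0.
have D1 y : V s y -> D y = 0 by move=> /DV /V2.
have D2 y : V 0 y -> D (D y) = 0.
  by move=> /DV; rewrite addr0 => /D1.
have D3 y : V (- s) y -> D (D (D y)) = 0.
  by move=> /DV; rewrite subrr => /D2.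
have DD y : V s (D (D y)) /\ D (D (D y)) = 0.
  have [y1 [y2 [y3 [h1 h2 h3 ->]]]] := dec y.
  rewrite /D !bracketDr -/D (D1 _ h1) (D2 _ h2) (D3 _ h3) !D0 !add0r.
  by split => //; have := DV _ _ (DV _ _ h3); rewrite subrr addr0.
have D3y y : D (D (D y)) = 0 by case: (DD y).
have DDDD a b : bracket (D (D a)) (D (D b)) = 0.
  by apply: V2; apply: VD; [case: (DD a)|case: (DD b)].
have Dd a b : D (bracket a b) = bracket (D a) b + bracket a (D b).
  exact: ad_derivation.
have Da a b : D (a + b) = D a + D b by exact: bracketDr.
have lin (z : L) : linear (exp_ad z).
  move=> k u v; rewrite /exp_ad !bracketDr !bracketZr !scalerDr !scalerA.
  by rewrite (mulrC k) (AC ((2*2)*2) ((1*3*5)*(2*4*6))).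
have DN a : D (- a) = - D a by exact: bracketNr.
have DZ k a : D (k *: a) = k *: D a by exact: bracketZr.
have e1 y : exp_ad x y = y + D y + 2%:R^-1 *: D (D y) by [].
have e2 y : exp_ad (- x) y = y - D y + 2%:R^-1 *: D (D y).
  by rewrite /exp_ad !bracketNl bracketNr opprK.
clearbody D.
have DDD a b : bracket (D (D a)) (D b) + bracket (D a) (D (D b)) = 0.
  have := D3y (bracket a b).
  rewrite !(Dd, Da) !D3y bracket0l bracketr0 add0r addr0.
  set p := bracket _ _; set r := bracket _ _ => h.
  have : 3%:R *: (p + r) = 0.
    rewrite -h (scaler_nat 3 (p + r)) !mulrS mulr0n addr0.
    by rewrite -!addrA; congr (_ + _); rewrite addrCA; congr (_ + (_ + _));
      rewrite addrCA.
  by move/eqP; rewrite scaler_eq0 (negPf K3) => /eqP.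
have half (a : L) : 2%:R^-1 *: a + 2%:R^-1 *: a = a.
  by rewrite -mulr2n -scaler_nat scalerA mulfV // scale1r.
have mor : {morph exp_ad x : a b / bracket a b}.
  move=> a b; rewrite !e1 !(Dd, Da) !(bracketDl, bracketDr).
  rewrite !(bracketZl, bracketZr) DDDD !scaler0 addr0.
  have -> : bracket (D a) (D (D b)) = - bracket (D (D a)) (D b).
    by apply/eqP; rewrite -addr_eq0 addrC DDD.
  rewrite !scalerDr scalerN; set A := _ *: bracket (D (D a)) b.
  set B := bracket (D a) (D b); set C := _ *: bracket a _; set Z := _ *: bracket _ (D b).
  rewrite (addrC (_ *: B)) (addrACA A) half.
  by rewrite [RHS](AC ((3*3)*2) (((1*(4*2))*((7*3)*5))*(8*6))) /= subrr addr0.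
have can : cancel (exp_ad x) (exp_ad (- x)).
  move=> a; rewrite e1 e2 !(Da, DZ, D3y) D0 !scaler0 !addr0.
  rewrite opprD (AC (3*2*1) ((1*(2*4))*((3*6)*5))) /= subrr addr0 half.
  by rewrite subrr addr0.
have can' : cancel (exp_ad (- x)) (exp_ad x).
  move=> a; rewrite e1 e2 !(Da, DZ, DN, D3y) D0 oppr0 !scaler0 !addr0.
  rewrite (AC (3*2*1) ((1*(4*2))*((3*6)*5))) /= subrr addr0 half.
  by rewrite subrr addr0.
by exists (LieAut (lin x) mor (Bijective can can')).
Qed.

End ExpAd.

Record centralExt (K : fieldType) (Lh L : gradedLieType K) := CentralExt {
  ext_fun :> Lh -> L;
  ext_linear : linear ext_fun;
  ext_bracket : {morph ext_fun : x y / bracket x y};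
  ext_surj : forall y, exists x, ext_fun x = y;
  ext_central : forall x, ext_fun x = 0 -> lie_center x;
  ext_grade : forall i : int, i \in [:: 1; 0; -1] ->
    forall x, grade Lh i x -> grade L i (ext_fun x) }.

Section Induced.
Variables (K : fieldType) (Lh L : gradedLieType K) (q : centralExt Lh L).

HB.instance Definition _ := GRing.isLinear.Build K Lh L _ q (ext_linear q).

Lemma exp_ad_ext x y : q (exp_ad x y) = exp_ad (q x) (q y).
Proof. by rewrite /exp_ad !linearD linearZ /= !ext_bracket. Qed.

Lemma exp_ad_ker x y : q y = 0 -> exp_ad x y = y.
Proof.
move=> /(@ext_central _ _ _ q) zy.
suff xy0 : bracket x y = 0.
  by rewrite /exp_ad xy0 bracketr0 scaler0 !addr0.
by rewrite bracketC zy oppr0.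
Qed.

Lemma induced_gen (a : lieAut Lh) : elem_gens a ->
  exists2 b : lieAut L, elem_gens b & forall x, b (q x) = q (a x).
Proof.
case=> x gx ax.
have bq y : exp_ad (q x) (q y) = q (a y) by rewrite ax exp_ad_ext.
have lb : linear (exp_ad (q x)).
  move=> k u v; have [u' <-] := ext_surj q u; have [v' <-] := ext_surj q v.
  by rewrite -linearP !bq lieAut_linear linearP.
have mb : {morph exp_ad (q x) : u v / bracket u v}.
  move=> u v; have [u' <-] := ext_surj q u; have [v' <-] := ext_surj q v.
  by rewrite -ext_bracket !bq lieAut_bracket ext_bracket.
have bb : bijective (exp_ad (q x)).
  have [a' aa' a'a] := lieAut_bij a.
  have fixk z : q z = 0 -> a z = z by rewrite ax; exact: exp_ad_ker.
  pose s y := sval (cid (ext_surj q y)).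
  have qs y : q (s y) = y by rewrite /s; case: cid.
  have bi : injective (exp_ad (q x)).
    move=> u v; rewrite -(qs u) -(qs v) !bq => e.
    have aB : a (s u - s v) = a (s u) - a (s v).
      have := lieAut_linear a (-1) (s v) (s u).
      by rewrite !scaleN1r ![- _ + _]addrC.
    have e0 : q (a (s u - s v)) = 0 by rewrite aB linearB /= e subrr.
    have := can_inj aa' (fixk _ e0) => e1.
    by apply/eqP; rewrite -subr_eq0 -linearB /= -{1}e1; apply/eqP.
  have bs y : exp_ad (q x) (q (a' (s y))) = y by rewrite bq a'a qs.
  exists (fun y => q (a' (s y))) => // y.
  by apply: bi; rewrite bs.
exists (LieAut lb mb bb) => //; exists (q x) => //.
by case: gx => gx; [left | right]; apply: ext_grade.
Qed.

Lemma induced_ex (a : elemGroup Lh) :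
  exists b : elemGroup L, forall x, b (q x) = q (a x).
Proof.
pose A := [set a : lieAut Lh |
  exists b : elemGroup L, forall x, b (q x) = q (a x)].
suff: A (elem_val a) by [].
have /set_mem := elem_valP a; apply; split.
  split; first by apply/mem_set; exists 1%g.
  move=> c d /set_mem[c' cc'] /set_mem[d' dd']; apply/mem_set.
  exists (c' / d')%g => x.
  have -> : q x = d' (q ((d^-1)%g x)).
    by rewrite dd' -lieAutME mulgV.
  by rewrite -elemME mulgVK cc'.
move=> c /induced_gen[b gb bc].
have Gb : in_elemGroup b by apply/mem_set => B [_]; apply.
by exists (ElemGroup Gb).
Qed.

(* The unique map q_G with q_G(a) \o q = q \o a, see elemHomE. *)
Definition elemHom (a : elemGroup Lh) : elemGroup L := sval (cid (induced_ex a)).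

Lemma elemHomE (a : elemGroup Lh) (x : Lh) : elemHom a (q x) = q (a x).
Proof. by rewrite /elemHom; case: cid. Qed.

Lemma elemHom_uniq (a : elemGroup Lh) (b : elemGroup L) :
  (forall x : Lh, b (q x) = q (a x)) -> b = elemHom a.
Proof.
move=> h; apply: val_inj; apply: lieAutP => y.
by have [x <-] := ext_surj q y; rewrite h /= elemHomE.
Qed.

Lemma elemHomF : {morph elemHom : a b / (a / b)%g}.
Proof.
move=> a b; apply/esym/elemHom_uniq => x.
have -> : q x = elemHom b (q ((b^-1)%g x)).
  by rewrite elemHomE -elemME mulgV.
by rewrite -elemME mulgVK elemHomE.
Qed.

HB.instance Definition _ :=
  isGroupMorphism.Build (elemGroup Lh) (elemGroup L) elemHom elemHomF.

End Induced.

Definition ltrans (G : groupType) (a : G) (A : set G) : set G :=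
  [set (a * x)%g | x in A].

Definition coset_space (G : groupType) (P : set G) : set (set G) :=
  [set ltrans a P | a in [set: G]].

(* G' acts on G' / P' by left translation and on G / P through phi. *)
Definition homogeneous_iso (G' G : groupType) (phi : G' -> G)
  (P' : set G') (P : set G) : Prop :=
  exists f : set G' -> set G,
    set_bij (coset_space P') (coset_space P) f /\
    forall (a : G') (A : set G'), coset_space P' A ->
      f (ltrans a A) = ltrans (phi a) (f A).

(* Main.v *)
Require Import Defs.
From HB Require Import structures.
From mathcomp Require Import all_boot all_order all_algebra.
From mathcomp Require Import boolp classical_sets functions.

Set Implicit Arguments.
Unset Strict Implicit.
Unset Printing Implicit Defensive.
Import GRing.Theory.
Local Open Scope ring_scope.
Local Open Scope classical_set_scope.

(** Everything takes place on the fibres of the central extension.  If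
    [elemHom q g] commutes with [ad E], then [w = g Eh - Eh] has ad w with
    values in ker q.  So ad w is a derivation into the centre and kills all
    brackets; it also kills Eh, because the central element [Eh, w] is
    annihilated by ad Eh, and hence vanishes by ad(Eh)^3 = ad(Eh).
    Since Lh is spanned by Eh and brackets, w is central, which says exactly that
    g commutes with ad Eh ([elemHom_preim_elemH]).

    The rest rests on lifting: every homogeneous x of degree 1 or -1 lifts to a
    homogeneous element of the same degree ([grade_lift]), so exp(ad x) lifts to
    exp(ad xh).  Dividing by such a lift reduces the parabolic subgroups to
    the case of H ([elemHom_preim_elemP]), and applying it to the generators
    shows that [elemHom q] is onto ([elemHom_surj]).  The isomorphisms of
    homogeneous spaces are then the general fact [homogeneous_iso_preim]
    that a surjective group morphism identifies the cosets of a preimage with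
    the cosets downstairs. *)

(** A coset [a P'] of the preimage P' of P is the preimage of [phi a P], so
    taking images under phi inverts taking preimages on coset spaces. *)
Lemma homogeneous_iso_preim (G' G : groupType)
    (phi : UMagmaMorphism.type G' G) (P : set G) :
  (forall b, exists a, phi a = b) ->
  homogeneous_iso phi (phi @^-1` P) P.
Proof.
move=> phi_surj.
have imE a : phi @` ltrans a (phi @^-1` P) = ltrans (phi a) P.
  apply/seteqP; split => [_ [_ [x Px <-] <-]|_ [p Pp <-]].
    by exists (phi x) => //; rewrite gmulfM.
  have [x xp] := phi_surj p.
  exists (a * x)%g; last by rewrite gmulfM xp.
  by exists x => //=; rewrite xp.
have preimE a : phi @^-1` ltrans (phi a) P = ltrans a (phi @^-1` P).
  apply/seteqP; split => [x [p Pp /= e]|_ [x Px <-]].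
    exists (a^-1 * x)%g; last by rewrite mulVKg.
    by rewrite /= gmulfM gmulfV -e mulKg.
  by exists (phi x) => //; rewrite gmulfM.
have ltransM (H : groupType) (b c : H) A :
    ltrans b (ltrans c A) = ltrans (b * c)%g A.
  apply/seteqP; split => [_ [_ [x Ax <-] <-]|_ [x Ax <-]].
    by exists x => //; rewrite mulgA.
  by exists (c * x)%g; [exists x | rewrite mulgA].
exists (fun A => phi @` A); split.
  split.
  - by move=> _ [a _ <-]; exists (phi a) => //; rewrite imE.
  - move=> _ _ /set_mem[a _ <-] /set_mem[b _ <-].
    by rewrite !imE => e; rewrite -!preimE e.
  - move=> _ [b _ <-]; have [a <-] := phi_surj b.
    by exists (ltrans a (phi @^-1` P)); [exists a | exact: imE].
by move=> a _ [b _ <-]; rewrite ltransM !imE ltransM gmulfM.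
Qed.

Section CentralExtension.
Variables (K : fieldType) (Lh L : gradedLieType K) (q : centralExt Lh L).
Hypothesis K2 : 2%:R != 0 :> K.
Hypothesis qE : q (gradeE Lh) = gradeE L.

Local Notation Eh := (gradeE Lh).

(** The lift is the image of an arbitrary preimage under the projection
    (ad(Eh)^2 + i ad(Eh)) / 2 onto the eigenspace of degree i. *)
Lemma grade_lift (i : int) (y : L) : i * i = 1 -> grade L i y ->
  exists2 x : Lh, grade Lh i x & q x = y.
Proof.
move=> ii gy; have [x xy] := ext_surj q y.
have ss : i%:~R * i%:~R = 1 :> K by rewrite -intrM ii.
have Ey : ad (gradeE L) y = i%:~R *: y by rewrite gy scaler_int.
exists (2%:R^-1 *: (ad Eh (ad Eh x) + i%:~R *: ad Eh x)).
  rewrite /grade /= -scaler_int bracketZr bracketDr bracketZr ad_gradeE3.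
  rewrite scalerA (mulrC i%:~R) -scalerA [in RHS]scalerDr scalerA ss scale1r.
  by rewrite addrC.
rewrite linearZ linearD linearZ /= !ext_bracket qE xy Ey bracketZr Ey.
by rewrite scalerA ss scale1r -mulr2n -scaler_nat scalerA mulVf // scale1r.
Qed.

(** The inner derivation ad w takes values in ker q, hence in the centre, and
    therefore kills all brackets.  Any y is the sum of the bracket
    [Eh, [Eh, y]] and a term of degree 0, so only [w, Eh] is left. *)
Lemma center_lift (w : Lh) : grade0_generated Lh ->
  (forall y, q (bracket w y) = 0) -> lie_center w.
Proof.
move=> Lh0 qw.
have cw y z : bracket (bracket w y) z = 0 by exact: (ext_central (qw y)).
have w_bracket a b : bracket w (bracket a b) = 0.
  by rewrite ad_derivation cw bracketC cw oppr0 addr0.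
have wE : bracket w Eh = 0.
  have E2 : ad Eh (ad Eh w) = 0.
    by rewrite bracketC (bracketC Eh w) bracketNl cw !oppr0.
  by rewrite bracketC -ad_gradeE3 E2 bracketr0 oppr0.
move=> y; rewrite -(subrK (ad Eh (ad Eh y)) y) bracketDr w_bracket addr0.
have : grade Lh 0 (y - ad Eh (ad Eh y)).
  by rewrite /grade /= bracketDr bracketNr ad_gradeE3 subrr.
rewrite {1}Lh0 => -[c _ [_ [n [a [b [_ _ ->]]]] <-]].
rewrite bracketDr bracketZr wE scaler0 add0r.
by elim/big_ind: _ => [|u v wu wv|j _];
  rewrite ?bracketr0 ?bracketDr ?wu ?wv ?addr0 ?w_bracket.
Qed.

Lemma elemHom_preim_elemH : grade0_generated Lh ->
  elemHom q @^-1` elemH L = elemH Lh.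
Proof.
move=> Lh0; apply/seteqP; split => [g Hg x|g Hg y]; last first.
  have [x <-] := ext_surj q y.
  by rewrite -qE -ext_bracket !elemHomE Hg ext_bracket.
have cE : lie_center (g Eh - Eh).
  apply: center_lift => // y.
  (* Every y is some g z, and [g Eh - Eh, g z] = g [Eh, z] - [Eh, g z]. *)
  have [g' _ gg'] := lieAut_bij g.
  rewrite -(gg' y); set z := g' y.
  rewrite bracketDl bracketNl -lieAut_bracket linearB /=.
  rewrite -elemHomE !ext_bracket qE Hg elemHomE.
  by rewrite subrr.
apply/eqP; rewrite lieAut_bracket -subr_eq0 -bracketNl -bracketDl.
by rewrite cE.
Qed.

Hypothesis K3 : 3%:R != 0 :> K.

Lemma elemHom_lift_exp_ad (i : int) (x : Lh) : i \in [:: 1; -1] ->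
  grade Lh i x ->
  exists2 u : elemGroup Lh, elemU Lh i u & elemHom q u =1 exp_ad (q x).
Proof.
move=> i1 gx.
have gx' : (grade Lh 1 `|` grade Lh (- 1)) x.
  by move: i1 gx; rewrite !inE => /orP[] /eqP ->; [left | right].
have [a ax] := exp_ad_aut K2 K3 gx'.
have Ga : in_elemGroup a by apply/mem_set => B [_]; apply; exists x.
exists (ElemGroup Ga) => [|y]; first by exists x.
by have [z <-] := ext_surj q y; rewrite elemHomE /= ax exp_ad_ext.
Qed.

(** Only the generators need lifting, as the image of a morphism is a
    subgroup. *)
Lemma elemHom_surj (b : elemGroup L) : exists a, elemHom q a = b.
Proof.
pose A := [set c : lieAut L | exists a : elemGroup Lh, elemHom q a = c :> lieAut L].
suff [a ab] : A (elem_val b) by exists a; apply: val_inj.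
have /set_mem := elem_valP b; apply; split.
  split; first by apply/mem_set; exists 1%g; rewrite gmulf1.
  move=> c d /set_mem[a ac] /set_mem[a' ad]; apply/mem_set.
  by exists (a / a')%g; rewrite -ac -ad elemHomF.
move=> c [y gy cy].
have [i [i1 ii {}gy]] : exists i : int, [/\ i \in [:: 1; -1], i * i = 1 & grade L i y].
  by case: gy => gy; [exists 1 | exists (-1)].
have [x gx xy] := grade_lift ii gy.
have [u _ ux] := elemHom_lift_exp_ad i1 gx.
by exists u; apply: lieAutP => z; rewrite ux xy cy.
Qed.

(** If [elemHom q g = h u] with u = exp(ad x), then dividing g by a
    lift of u gives an element over h, to which the case of H applies. *)
Lemma elemHom_preim_elemP (i : int) : i \in [:: 1; -1] ->
  grade0_generated Lh ->
  elemHom q @^-1` elemP L i = elemP Lh i.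
Proof.
move=> i1 Lh0; have HH := elemHom_preim_elemH Lh0.
have ii : i * i = 1 by move: i1; rewrite !inE => /orP[] /eqP ->.
apply/seteqP; split => [g [h Hh [u [y gy uy] /= e]]|_ [h Hh [u [x gx ux] <-]]].
  have [x gx xy] := grade_lift ii gy.
  have [v Uv vx] := elemHom_lift_exp_ad i1 gx.
  have vu : elemHom q v = u.
    by apply/val_inj/lieAutP => z; rewrite /= vx uy xy.
  exists (g / v)%g; last by exists v; rewrite ?mulgVK.
  by rewrite -HH /= elemHomF -e vu mulgK.
exists (elemHom q h); first by move: Hh; rewrite -HH.
exists (elemHom q u); last by rewrite gmulfM.
exists (q x).
  by apply: ext_grade gx; move: i1; rewrite !inE => /orP[] ->; rewrite ?orbT.
by move=> y; have [z <-] := ext_surj q y; rewrite elemHomE ux exp_ad_ext.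
Qed.

End CentralExtension.

Theorem theorem7p10 (K : fieldType) (K2 : 2%:R != 0 :> K) (K3 : 3%:R != 0 :> K)
    (Lh L : gradedLieType K) (q : centralExt Lh L)
    (qE : q (gradeE Lh) = gradeE L)
    (L0 : grade0_generated L) (Lh0 : grade0_generated Lh) :
  [/\ elemHom q @^-1` elemH L = elemH Lh,
      elemHom q @^-1` elemP L 1 = elemP Lh 1 &
      elemHom q @^-1` elemP L (- 1) = elemP Lh (- 1)] /\
  [/\ homogeneous_iso (elemHom q) (elemP Lh 1) (elemP L 1),
      homogeneous_iso (elemHom q) (elemP Lh (- 1)) (elemP L (- 1)) &
      homogeneous_iso (elemHom q) (elemH Lh) (elemH L)].
Proof.
have preH := elemHom_preim_elemH qE Lh0.
have preP i i1 := @elemHom_preim_elemP _ _ _ _ K2 qE K3 i i1 Lh0.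
have surj := elemHom_surj K2 qE K3.
split; first by split; [exact: preH | exact: preP | exact: preP].
split.
- by rewrite -preP //; exact: homogeneous_iso_preim.
- by rewrite -preP //; exact: homogeneous_iso_preim.
- by rewrite -preH; exact: homogeneous_iso_preim.
Qed.
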